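(* Let $N$ be a finite set of items with sizes $s(i)>0$ and $f:2^N\to\mathbb{R}_{\ge0}$ normalized, monotone and submodular, and assume no ties occur in any comparison of values, marginal values or densities. Let $\Pi$ be the robust packing policy described in the context, and for a capacity $C>0$ let $\Pi(C)$ be the set it packs and $\mathrm{AG}(C)$ the output of AGreedy with capacity $C$. Then $f(\Pi(C))\ge f(\mathrm{AG}(C))$ for every $C>0$.
   Context: $s(A)=\sum_{i\in A}s(i)$. $f$ normalized: $f(\emptyset)=0$; monotone: $f(A)\le f(B)$ for $A\subseteq B$; submodular: $f(A)+f(B)\ge f(A\cup B)+f(A\cap B)$. Greedy order for capacity $\gamma$: $N_\gamma=\{i: s(i)\le\gamma\}$, $n_\gamma=|N_\gamma|$; $G_0=\emptyset$, and for $j=1,\dots,n_\gamma$, $i_j$ maximizes $\frac{f(G_{j-1}\cup\{i\})-f(G_{j-1})}{s(i)}$ over $i\in N_\gamma\setminus G_{j-1}$, $G_j=G_{j-1}\cup\{i_j\}$. Let $k$ be the largest index with $s(G_k)\le\gamma$. AGreedy returns $G_k$ if $k=n_\gamma$; otherwise $G_k$ if $f(G_k)\ge f(G_k\cup\{i_{k+1}\})-f(G_k)$, else $\{i_{k+1}\}$. An item $i$ is indispensable if for some capacity AGreedy returns $\{i\}=\{i_{k+1}\}$. A policy, not knowing the capacity $C$, repeatedly attempts items; an item that fits (packed total plus its size $\le C$) is irrevocably packed, otherwise discarded. The policy $\Pi$: First build a list $F$: go through the items in order of non-decreasing size; an item $i$ is put at the front of $F$ if it is indispensable, or if it is the first item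 of the greedy order for capacity $s(i)$ and $F$ is already nonempty. Execution with candidate set $N'$ (initially $N$): Step 1: go through $F$ in order; for the current item $i$ attempt to pack it; if it does not fit, set $N'\leftarrow\{i'\in N': s(i')<s(i)\}$ and continue; the first item $i$ that fits is packed ($S=\{i\}$, removed from $N'$) and Step 1 ends; if it is indispensable let $G$ be the items preceding $i$ in the greedy order for capacity $s(i)$, else $G=\emptyset$ (also $G=\emptyset$ if no item of $F$ fits). Step 2: for each $i\in G$ in greedy order, add it to $S$ if it fits, and remove it from $N'$. Step 3: while $N'\ne\emptyset$, let $i_{\max}$ maximize $\frac{f(S\cup\{i\})-f(S)}{s(i)}$ over $N'$; if it fits add it to $S$ and remove it from $N'$, else set $N'\leftarrow\{i\in N': s(i)<s(i_{\max})\}$. Output $S$. *)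

(* Defs.v *)
From HB Require Import structures.
From mathcomp Require Import all_boot all_order all_algebra.
From mathcomp Require Import boolp reals.

Set Implicit Arguments.
Unset Strict Implicit.
Unset Printing Implicit Defensive.

Import Order.TTheory GRing.Theory Num.Theory.
Local Open Scope ring_scope.

Section SetFunctions.
Variables (R : realType) (N : finType).
Implicit Type f : {set N} -> R.

Definition normalized f : Prop := f set0 = 0.

Definition monotone f : Prop := forall A B : {set N}, A \subset B -> f A <= f B.

Definition submodular f : Prop :=
  forall A B : {set N}, f (A :|: B) + f (A :&: B) <= f A + f B.

End SetFunctions.

Section Packing.
Variables (R : realType) (N : finType) (s : N -> R) (f : {set N} -> R).
Implicit Types (i : N) (S A : {set N}) (g C : R).

Definition size_of A : R := \sum_(i in A) s i.

Definition marginal S i : R := f (i |: S) - f S.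

Definition density S i : R := marginal S i / s i.

(* [None] only if A is empty. *)
Definition densest S A : option N :=
  [pick i in A | [forall j in A, density S j <= density S i]].

Definition small_items g : {set N} := [set i | s i <= g].

Fixpoint greedy_from (n : nat) S A : seq N :=
  if n is n'.+1 then
    if densest S A is Some i then i :: greedy_from n' (i |: S) (A :\ i)
    else [::]
  else [::].

Definition greedy_order g : seq N :=
  greedy_from #|small_items g| set0 (small_items g).

Definition greedy_set g (j : nat) : {set N} :=
  [set i in take j (greedy_order g)].

Definition greedy_len g : nat :=
  \max_(j < #|small_items g|.+1 | size_of (greedy_set g j) <= g) j.

(* With k = greedy_len g, this is the (k+1)-st item of the greedy order, which
   sits at position k; it is [None] exactly when k is the number of items of
   size at most g. *)
Definition next_item g : option N := onth (greedy_order g) (greedy_len g).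

Definition agreedy g : {set N} :=
  let G := greedy_set g (greedy_len g) in
  if next_item g is Some i then
    if marginal G i <= f G then G else [set i]
  else G.

Definition indispensable i : Prop :=
  exists g : R, [/\ 0 < g, next_item g = Some i & agreedy g = [set i]].

Definition first_greedy i : bool := ohead (greedy_order (s i)) == Some i.

(* [ord] lists all items by non-decreasing size. *)
Definition build_list (ord : seq N) : seq N :=
  foldl (fun F i => if `[< indispensable i >] || (first_greedy i && (F != [::]))
                    then i :: F else F)
        [::] ord.

Definition fits C S i : bool := size_of S + s i <= C.

(* Returns the packed item, if any, and the remaining candidates. *)
Fixpoint step1 C (F : seq N) A : option N * {set N} :=
  if F is i :: F' then
    if fits C set0 i then (Some i, A :\ i)
    else step1 C F' [set j in A | s j < s i]
  else (None, A).

Definition items_before i : seq N :=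
  let o := greedy_order (s i) in take (index i o) o.

(* A state is the pair (packed items, remaining candidates). *)
Definition state : Type := ({set N} * {set N})%type.

Definition step2_item C (st : state) i : state :=
  (if fits C st.1 i then i |: st.1 else st.1, st.2 :\ i).

Definition step3_item C (st : state) : state :=
  if densest st.1 st.2 is Some i then
    if fits C st.1 i then (i |: st.1, st.2 :\ i)
    else (st.1, [set j in st.2 | s j < s i])
  else st.

Definition after_step1 (ord : seq N) C : state * seq N :=
  match step1 C (build_list ord) setT with
  | (Some i, A) => (([set i], A), if `[< indispensable i >] then items_before i
                                  else [::])
  | (None, A) => ((set0, A), [::])
  end.

Definition after_step2 (ord : seq N) C : state :=
  let: (st, G) := after_step1 ord C in foldl (step2_item C) st G.

Definition step3_state (ord : seq N) C (n : nat) : state :=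
  iter n (step3_item C) (after_step2 ord C).

(* Every round of the last step with candidates left removes at least one of
   them, so that #|N| rounds exhaust the candidates. *)
Definition policy (ord : seq N) C : {set N} := (step3_state ord C #|N|).1.

(* No ties among the values compared in a run of AGreedy or of the policy, for
   any capacity: densities when a greedy order is built, the two values that
   decide the output of AGreedy, and densities in the last step of the policy.
   Sizes may coincide. *)
Definition no_ties (ord : seq N) : Prop :=
  [/\ forall g (j : nat), 0 < g ->
        {in small_items g :\: greedy_set g j &,
          injective (density (greedy_set g j))},
      forall g i, 0 < g -> next_item g = Some i ->
        f (greedy_set g (greedy_len g))
          <> marginal (greedy_set g (greedy_len g)) i
    & forall C (n : nat), 0 < C ->
        {in (step3_state ord C n).2 &,
          injective (density (step3_state ord C n).1)}].

End Packing.

(* Main.v *)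
(* Call [p] a greedy sequence for capacity g if it is an initial segment of the
   greedy order for g; without ties, two such sequences are comparable. If x
   follows p in a greedy order and has a marginal larger than f(p), then by
   density all items of p are smaller than x and s(p) <= s(x); hence p x is also
   a greedy sequence for capacity s(x), and x is indispensable unless p is empty.

   Let x be the item packed by Step 1, the largest listed item that fits C, and
   suppose the greedy order for C left the order p x of capacity s(x), where p
   are the items before x if x is indispensable, and p is empty otherwise. The
   first item y at which it does is larger than s(x) and, by the previous
   remark, is indispensable or the first item for capacity s(y). So y is listed
   as well, a contradiction. Therefore Steps 1 and 2 pack an initial segment of
   the greedy order for C, and Step 3 continues along it until all of G_k is
   packed. If AGreedy returns a single item i instead, then i is listed, so
   s(i) <= s(x), and comparing the two greedy sequences gives f(i) <= f(x). *)

Require Import Defs.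
From mathcomp Require Import all_boot all_order all_algebra.
From mathcomp Require Import boolp reals.

Set Implicit Arguments.
Unset Strict Implicit.
Unset Printing Implicit Defensive.

Import Order.TTheory GRing.Theory Num.Theory.
Local Open Scope ring_scope.

Section Greedy.
Variables (R : realType) (N : finType) (s : N -> R) (f : {set N} -> R).
Hypotheses (s_gt0 : forall i : N, 0 < s i) (f_ge0 : forall A : {set N}, 0 <= f A).
Hypotheses (f_norm : normalized f) (f_mono : monotone f) (f_submod : submodular f).
Implicit Types (g : R) (S A B : {set N}) (p q r : seq N) (x y z : N).

Local Notation dens p := (density s f [set z in p]).
Local Notation marg p := (marginal f [set z in p]).
Local Notation size_seq p := (size_of s [set z in p]).

(** * Sequences, prefixes and the sets they span *)

Lemma set_rcons p x : [set z in rcons p x] = x |: [set z in p].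
Proof. by apply/setP => z; rewrite !inE mem_rcons inE. Qed.

Lemma set_nil : [set z in [::]] = set0 :> {set N}.
Proof. by apply/setP => z; rewrite !inE. Qed.

Lemma set_prefix p q : prefix p q -> [set z in p] \subset [set z in q].
Proof.
by case/prefixP=> r ->; apply/subsetP => z; rewrite !inE mem_cat => ->.
Qed.

Lemma prefix_of_rcons p q x :
  prefix p (rcons q x) -> prefix p q \/ p = rcons q x.
Proof.
case/prefixP; elim/last_ind => [|r y _]; first by rewrite cats0; right.
by rewrite -rcons_cat => /rcons_inj[-> _]; left; rewrite prefix_prefix.
Qed.

Lemma prefix_total p q r : prefix p r -> prefix q r ->
  prefix p q \/ prefix q p.
Proof.
move=> /prefixP[p' def_r] /prefixP[q' def_r'].
case: (leqP (size p) (size q)) => [le_pq|/ltnW le_qp]; [left | right].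
  by rewrite prefixE -(takel_cat q' le_pq) -def_r' def_r take_size_cat.
by rewrite prefixE -(takel_cat p' le_qp) -def_r def_r' take_size_cat.
Qed.

(** * Sizes, marginals and densities *)

Lemma size_of0 : size_of s set0 = 0.
Proof. by rewrite /size_of big_set0. Qed.

Lemma size_ofU1 A x : x \notin A -> size_of s (x |: A) = s x + size_of s A.
Proof. by move=> xA; rewrite /size_of big_setU1. Qed.

Lemma size_of_sub A B : A \subset B -> size_of s A <= size_of s B.
Proof.
move=> sAB; rewrite /size_of [leRHS](big_setID A) /= (setIidPr sAB).
by rewrite lerDl sumr_ge0 // => i _; apply: ltW.
Qed.

Lemma size_of_ge0 A : 0 <= size_of s A.
Proof. by rewrite -size_of0 size_of_sub ?sub0set. Qed.

(** Submodularity for [x |: A] and [B], which meet in [A] because [x] is outside [B]. *)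
Lemma marginal_anti A B x : A \subset B -> x \notin B ->
  marginal f B x <= marginal f A x.
Proof.
move=> sAB xB; have := f_submod (x |: A) B.
have -> : (x |: A) :|: B = x |: B by rewrite -setUA (setUidPr sAB).
have -> : (x |: A) :&: B = A.
  rewrite setIUl (setIidPl sAB); suff -> : [set x] :&: B = set0 by rewrite set0U.
  by apply/setP => z; rewrite !inE; case: eqP => // ->; rewrite (negPf xB).
by rewrite /marginal lerBlDr addrAC lerBrDr.
Qed.

Lemma density_anti A B x : A \subset B -> x \notin B ->
  density s f B x <= density s f A x.
Proof.
by move=> sAB xB; rewrite ler_pM2r ?invr_gt0 ?marginal_anti.
Qed.

Lemma marginalE A x : marginal f A x = density s f A x * s x.
Proof. by rewrite /density divfK ?gt_eqF. Qed.

Lemma marginal_le_setU1 A x : marginal f A x <= f (x |: A).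
Proof. by rewrite /marginal gerBl. Qed.

Lemma marginal0 x : marginal f set0 x = f [set x].
Proof. by rewrite /marginal f_norm setU0 subr0. Qed.

Lemma marginal_le_singleton A x : x \notin A -> marginal f A x <= f [set x].
Proof. by move=> xA; rewrite -marginal0 marginal_anti ?sub0set. Qed.

(** A marginal is density times size; monotonicity makes the density of [y] non-negative, so the
    size may be enlarged. *)
Lemma marginal_le_of_density A x y : s x <= s y ->
  density s f A x <= density s f A y -> marginal f A x <= marginal f A y.
Proof.
move=> sxy dxy; rewrite !marginalE; apply: (@le_trans _ _ (density s f A y * s x)).
  by rewrite ler_pM2r.
by apply: ler_wpM2l => //; rewrite divr_ge0 ?(ltW (s_gt0 _)) // subr_ge0 f_mono ?subsetUr.
Qed.

(** * Greedy sequences and the greedy order *)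

Lemma densestP S A :
  if densest s f S A is Some i then
    i \in A /\ {in A, forall j, density s f S j <= density s f S i}
  else A = set0.
Proof.
rewrite /densest; case: pickP => [i /andP[iA /forallP i_max]|noi].
  by split=> // j jA; apply: (implyP (i_max j)).
apply/eqP/set0Pn => -[i0 i0A].
case: (arg_maxP (density s f S) i0A) => i iA i_max.
have := noi i; rewrite /= [i \in A]iA /= => /negbT/negP[].
by apply/forallP => j; apply/implyP => jA; apply: i_max.
Qed.

(** Each item is an optimal choice after those before it; [greedy_order] is not mentioned, so that
    the capacity can be varied. Once ties are excluded, [prefix_greedy_order] identifies these
    sequences with its initial segments. *)
Definition greedy_path g p : Prop :=
  uniq p /\
  forall q x r, p = q ++ x :: r ->
    s x <= g /\
    forall y, s y <= g -> y \notin q -> dens q y <= dens q x.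

Lemma greedy_path_cat g p q : greedy_path g (p ++ q) -> greedy_path g p.
Proof.
case=> + max_pq; rewrite cat_uniq => /and3P[p_uniq _ _]; split=> // p1 x r def_p.
by apply: (max_pq _ _ (r ++ q)); rewrite def_p -catA.
Qed.

Lemma greedy_path_prefix g p q :
  prefix p q -> greedy_path g q -> greedy_path g p.
Proof. by case/prefixP=> r ->; apply: greedy_path_cat. Qed.

Lemma greedy_path_rcons g p x :
  greedy_path g p -> x \notin p -> s x <= g ->
  (forall y, s y <= g -> y \notin p -> dens p y <= dens p x) ->
  greedy_path g (rcons p x).
Proof.
case=> p_uniq p_max xp sx x_max; split; first by rewrite rcons_uniq xp.
move=> q y; elim/last_ind => [|r z _].
  by rewrite cats1 => /rcons_inj[<- <-].
by rewrite -rcons_cons -rcons_cat => /rcons_inj[def_p _]; apply: (p_max _ _ r).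
Qed.

Lemma greedy_path_last g p x : greedy_path g (rcons p x) ->
  [/\ x \notin p, s x <= g
    & forall y, s y <= g -> y \notin p -> dens p y <= dens p x].
Proof.
case; rewrite rcons_uniq => /andP[xp _] p_max.
by have [|sx x_max] := p_max p x [::]; rewrite ?cats1.
Qed.

Lemma greedy_path_mem g p x : greedy_path g p -> x \in p -> s x <= g.
Proof.
move=> [_ p_max] /path.splitPr xp; case: xp p_max => p1 p2 p_max.
by have [] := p_max p1 x p2 erefl.
Qed.

(** Lowering the capacity only removes competitors. *)
Lemma greedy_path_restrict g g' p : greedy_path g p -> g' <= g ->
  (forall x, x \in p -> s x <= g') -> greedy_path g' p.
Proof.
move=> [p_uniq p_max] le_g' p_small; split=> // q x r def_p.
have [_ x_max] := p_max q x r def_p; split=> [|y sy].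
  by apply: p_small; rewrite def_p mem_cat mem_head orbT.
by apply: x_max; apply: le_trans le_g'.
Qed.

(** The induction needs a general start [S], since each round moves an item from [A] to [S]. *)
Lemma greedy_fromP n S A : #|A| = n ->
  let p := greedy_from s f n S A in
  [/\ uniq p, p =i A
    & forall q x r, p = q ++ x :: r -> {in A, forall y, y \notin q ->
        density s f (S :|: [set z in q]) y <= density s f (S :|: [set z in q]) x}].
Proof.
elim: n S A => [|n IH] S A cardA /=.
  have A0 : A = set0 by apply: cards0_eq.
  by split=> // [x|[]] //; rewrite A0 inE.
have := densestP S A; case: densest => [i [iA i_max]|A0]; last first.
  by rewrite A0 cards0 in cardA.
have [|p_uniq p_mem p_max] := IH (i |: S) (A :\ i).
  by have := cardsD1 i A; rewrite iA cardA => -[].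
set p := greedy_from _ _ _ _ _ in p_uniq p_mem p_max *; split=> /=.
- by rewrite p_mem !inE eqxx p_uniq.
- by move=> x; rewrite inE p_mem !inE; case: eqP => // ->; rewrite iA.
case=> [|j q] x r /=.
  by case=> <- _ y yA _; rewrite set_nil setU0; apply: i_max.
case=> <- def_p y yA; rewrite inE negb_or => /andP[yi yq].
have -> : S :|: [set z in i :: q] = (i |: S) :|: [set z in q].
  by apply/setP => z; rewrite !inE; do !case: (_ \in _); do !case: (_ == _).
by apply: (p_max q x r) => //; rewrite !inE yi.
Qed.

Lemma mem_greedy_order g x : (x \in greedy_order s f g) = (s x <= g).
Proof.
have [_ -> _] := @greedy_fromP _ set0 (small_items s g) erefl.
by rewrite inE.
Qed.

Lemma greedy_order_path g : greedy_path g (greedy_order s f g).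
Proof.
have [o_uniq o_mem o_max] := @greedy_fromP _ set0 (small_items s g) erefl.
split=> // q x r def_o; split.
  by rewrite -mem_greedy_order def_o mem_cat mem_head orbT.
move=> y sy yq; have := o_max q x r def_o y; rewrite !set0U; apply=> //.
by rewrite inE.
Qed.

Lemma size_greedy_order g : size (greedy_order s f g) = #|small_items s g|.
Proof.
have [o_uniq o_mem _] := @greedy_fromP _ set0 (small_items s g) erefl.
by rewrite -(eq_card o_mem) /greedy_order; apply/esym/card_uniqP.
Qed.

(** * How far AGreedy packs *)

Lemma greedy_len_bounds g : 0 < g ->
  size_of s (greedy_set s f g (greedy_len s f g)) <= g /\
  (greedy_len s f g <= size (greedy_order s f g))%N.
Proof.
move=> g_gt0; rewrite size_greedy_order /greedy_len.
apply: (big_ind (fun k => size_of s (greedy_set s f g k) <= g /\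
                  (k <= #|small_items s g|)%N)).
- by rewrite /greedy_set take0 set_nil size_of0 ltW.
- by move=> k1 k2 h1 h2; case: (leqP k1 k2).
- by move=> j sj; rewrite -ltnS.
Qed.

Lemma greedy_len_ge g p : prefix p (greedy_order s f g) -> size_seq p <= g ->
  (size p <= greedy_len s f g)%N.
Proof.
move=> p_pre sp; have := size_prefix p_pre.
rewrite size_greedy_order -ltnS => lt_p.
apply: (@leq_bigmax_cond _ _ (fun j : 'I_#|small_items s g|.+1 => (j : nat))
          (Ordinal lt_p)).
by rewrite /greedy_set /=; move: p_pre; rewrite prefixE => /eqP ->.
Qed.

(** A longer packed prefix would contain all of [rcons p x] and overflow. *)
Lemma greedy_len_eq g p x : 0 < g ->
  prefix (rcons p x) (greedy_order s f g) ->
  size_seq p <= g -> g < size_seq (rcons p x) ->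
  greedy_len s f g = size p.
Proof.
move=> g_gt0 px_pre sp spx; apply/eqP; rewrite eqn_leq andbC.
rewrite greedy_len_ge //=; last exact: prefix_trans (prefix_rcons _ _) px_pre.
rewrite leqNgt; apply/negP => lt_p.
have [sk _] := greedy_len_bounds g_gt0.
suff : size_seq (rcons p x) <= g by rewrite leNgt spx.
apply: le_trans sk; apply/size_of_sub/set_prefix.
move: px_pre; rewrite !prefixE size_rcons => /eqP def_px.
by rewrite take_takel // def_px.
Qed.

Lemma onth_prefix p q x : prefix (rcons p x) q -> onth q (size p) = Some x.
Proof.
by case/prefixP=> r ->; rewrite cat_rcons onth_cat ltnn subnn.
Qed.

Lemma onth_rcons_take q k x : onth q k = Some x ->
  prefix (rcons (take k q) x) q /\ size (take k q) = k.
Proof.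
elim: q k => [|y q IH] [|k] //=; first by case=> ->; rewrite eqxx prefix0s.
by case/IH => pre sz; rewrite eqxx pre sz.
Qed.

(** * Output of AGreedy; items worth more than all that precedes them *)

Lemma agreedyP g : 0 < g ->
  let p := take (greedy_len s f g) (greedy_order s f g) in
  (exists x, [/\ agreedy s f g = [set x], next_item s f g = Some x,
               prefix (rcons p x) (greedy_order s f g)
             & f [set z in p] < marg p x])
  \/ (agreedy s f g = [set z in p] /\
      forall x, next_item s f g = Some x -> marg p x <= f [set z in p]).
Proof.
move=> g_gt0 /=; rewrite /agreedy.
case def_x: next_item => [x|]; last by right.
have [x_pre _] := onth_rcons_take def_x.
rewrite /greedy_set; case: leP => [le_m|lt_m]; last by left; exists x.
by right; split=> // y [<-].
Qed.

(* An earlier item at least as large as [x] would have, by its density, a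
   marginal of at least that of [x]. *)
Lemma greedy_path_smaller g p x : greedy_path g (rcons p x) ->
  f [set z in p] < marg p x -> {in p, forall z, s z < s x}.
Proof.
move=> px_path lt_m z zp; rewrite ltNge; apply/negP => le_xz.
have [xp sx _] := greedy_path_last px_path.
case/path.splitPr: zp px_path lt_m xp => p1 p2 px_path lt_m xp.
have [_ /(_ p1 z (rcons p2 x))[|_ z_max]] := px_path; first by rewrite rcons_cat.
have xp1 : x \notin p1 by apply: contra xp; rewrite mem_cat => ->.
have sub1 : [set y in p1] \subset [set y in p1 ++ z :: p2].
  exact/set_prefix/prefix_prefix.
have le1 := marginal_le_of_density le_xz (z_max x sx xp1).
have le2 : marg (p1 ++ z :: p2) x <= marg p1 x by apply: marginal_anti; rewrite ?inE.
have le3 : f (z |: [set y in p1]) <= f [set y in p1 ++ z :: p2].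
  by rewrite -set_rcons -cat_rcons; apply/f_mono/set_prefix/prefix_prefix.
(* The chain is [f p < marg p x <= marg p1 x <= marg p1 z <= f (z |: p1)], against [le3]. *)
have := lt_le_trans lt_m (le_trans le2 (le_trans le1 (marginal_le_setU1 _ _))).
by rewrite ltNge le3.
Qed.

(* Every item of [p] was added at a density at least that of [x] on top of
   [p]. *)
Lemma greedy_path_density g p x : greedy_path g (rcons p x) ->
  dens p x * size_seq p <= f [set z in p].
Proof.
move=> px_path; have [xp sx _] := greedy_path_last px_path.
(* Induction over the prefixes [q], with the density of [x] still taken on top of all of [p]. *)
suff H q : prefix q p -> dens p x * size_seq q <= f [set z in q].
  exact/H/prefix_refl.
elim/last_ind: q => [|q y IH] q_pre; first by rewrite set_nil size_of0 mulr0.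
have q_pre' := prefix_trans (prefix_rcons q y) q_pre.
have q_path : greedy_path g (rcons q y).
  by apply: greedy_path_prefix px_path; apply: prefix_trans q_pre (prefix_rcons _ _).
have [yq _ y_max] := greedy_path_last q_path.
have xq : x \notin q.
  by apply: contra xp => xq; have := subsetP (set_prefix q_pre') x; rewrite !inE; apply.
rewrite set_rcons size_ofU1 ?inE // mulrDr -[f (y |: _)](subrK (f [set z in q])).
apply: lerD; last exact: IH.
rewrite -/(marginal _ _ _) marginalE ler_pM2r //.
apply: le_trans (y_max x sx xq); apply: density_anti; rewrite ?inE //.
exact: set_prefix.
Qed.

(** Were [p] larger than [x], then [f p] would be at least the density of [x] times [s x], which is
    the marginal of [x]. *)
Lemma greedy_path_size g p x : greedy_path g (rcons p x) ->
  f [set z in p] < marg p x -> size_seq p <= s x.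
Proof.
move=> px_path lt_m; rewrite leNgt; apply/negP => lt_xp.
have := lt_le_trans lt_m; move/(_ (dens p x * size_seq p)).
have m_gt0 : 0 < marg p x by apply: le_lt_trans lt_m.
have d_gt0 : 0 < dens p x by rewrite divr_gt0.
rewrite marginalE ler_pM2l // (ltW lt_xp) => /(_ isT).
by rewrite ltNge (greedy_path_density px_path).
Qed.

(** The items of [p] are smaller than [x], so the capacity can be lowered to [s x]. *)
Lemma greedy_path_own_size g p x : greedy_path g (rcons p x) ->
  f [set z in p] < marg p x -> greedy_path (s x) (rcons p x).
Proof.
move=> px_path lt_m; have [_ sx _] := greedy_path_last px_path.
apply: (greedy_path_restrict px_path) => // y.
rewrite mem_rcons inE => /predU1P[->//|yp].
exact/ltW/(greedy_path_smaller px_path).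
Qed.

(** * Uniqueness of greedy sequences without ties *)

Hypothesis order_no_ties : forall g (j : nat), 0 < g ->
  {in small_items s g :\: greedy_set s f g j &,
    injective (density s f (greedy_set s f g j))}.

(** The item [z] after [p] in the greedy order and [x] both maximize the density on top of [p], so
    they coincide. *)
Lemma prefix_greedy_order g p : 0 < g -> greedy_path g p ->
  prefix p (greedy_order s f g).
Proof.
move=> g_gt0; elim/last_ind: p => [|p x IH] px_path; first by rewrite prefix0s.
have /prefixP[[|z r] def_o] := IH (greedy_path_prefix (prefix_rcons _ _) px_path).
  have [xp sx _] := greedy_path_last px_path.
  by rewrite cats0 in def_o; rewrite -mem_greedy_order def_o (negPf xp) in sx.
have [xp sx x_max] := greedy_path_last px_path.
have [o_uniq /(_ _ _ _ def_o)[sz z_max]] := greedy_order_path g.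
have zp : z \notin p.
  by move: o_uniq; rewrite def_o cat_uniq /= negb_or => /and3P[_ /andP[]].
suff -> : x = z by rewrite def_o -cat_rcons prefix_prefix.
have def_p : greedy_set s f g (size p) = [set y in p].
  by rewrite /greedy_set def_o take_size_cat.
apply: (@order_no_ties g (size p)) => //; rewrite ?def_p ?inE ?xp ?zp //.
by apply/eqP; rewrite eq_le x_max // z_max.
Qed.

Lemma greedy_path_total g p q : 0 < g -> greedy_path g p -> greedy_path g q ->
  prefix p q \/ prefix q p.
Proof.
move=> g_gt0 p_path q_path.
by apply: (@prefix_total _ _ (greedy_order s f g)); apply: prefix_greedy_order.
Qed.

(** The witness is the capacity [s x]: there [p] fits, but adding [x] to the non-empty [p]
    overflows, so [x] is the next item. *)
Lemma indispensable_of_path g p x : greedy_path g (rcons p x) -> p != [::] ->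
  f [set z in p] < marg p x -> indispensable s f x.
Proof.
move=> px_path p_nil lt_m; exists (s x).
have [xp _ _] := greedy_path_last px_path.
have px_pre : prefix (rcons p x) (greedy_order s f (s x)).
  exact/prefix_greedy_order/(greedy_path_own_size px_path).
have def_k : greedy_len s f (s x) = size p.
  apply: (greedy_len_eq _ px_pre) => //; first exact: (greedy_path_size px_path lt_m).
  rewrite set_rcons size_ofU1 ?inE // ltrDl.
  case: p p_nil {px_path lt_m xp px_pre} => // y p _.
  apply: (lt_le_trans (s_gt0 y)); rewrite -[s y]addr0 -size_of0 -size_ofU1 ?inE //.
  by apply: size_of_sub; rewrite setU0 sub1set !inE eqxx.
have def_x : next_item s f (s x) = Some x by rewrite /next_item def_k (onth_prefix px_pre).
split=> //; rewrite /agreedy def_x /greedy_set def_k.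
have /prefixP[r ->] := px_pre; rewrite cat_rcons take_size_cat //.
by rewrite leNgt lt_m.
Qed.

(** Indispensability provides some capacity [g], while [items_before] uses [s x]. The items before
    [x] for [g] remain a greedy sequence for [s x], hence are the same. *)
Lemma indispensable_items_before x : indispensable s f x ->
  let p := items_before s f x in
  greedy_path (s x) (rcons p x) /\ f [set z in p] < marg p x.
Proof.
case=> g [g_gt0 def_x ag_x].
set q := take (greedy_len s f g) (greedy_order s f g).
have [qx_pre _] := onth_rcons_take def_x; rewrite -/q in qx_pre.
have qx_path := greedy_path_prefix qx_pre (greedy_order_path g).
have [xq _ _] := greedy_path_last qx_path.
(* The other possible output of AGreedy, the set of [q], does not contain [x]. *)
have lt_m : f [set z in q] < marg q x.
  move: ag_x; rewrite /agreedy def_x /greedy_set -/q; case: ltP => // _.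
  by move/setP/(_ x); rewrite !inE eqxx (negPf xq).
have px_path := greedy_path_own_size qx_path lt_m.
suff -> : items_before s f x = q by [].
have /prefixP[r def_o] := prefix_greedy_order (s_gt0 x) px_path.
rewrite /items_before def_o cat_rcons index_cat (negPf xq) /= eqxx addn0.
by rewrite take_size_cat.
Qed.

Lemma first_greedyP x : first_greedy s f x <-> greedy_path (s x) [:: x].
Proof.
rewrite /first_greedy; split=> [/eqP|x_path].
  case def_o: greedy_order => [//|y o] [def_y]; move: def_o; rewrite def_y => def_o.
  by apply: (@greedy_path_cat _ _ o); rewrite /= -def_o; apply: greedy_order_path.
by have /prefixP[r ->] := prefix_greedy_order (s_gt0 x) x_path.
Qed.

(** The capacity may be raised if the greedy choice for [g] never exceeds [g'] along [p]: that
    choice then competes for [g'] too, where the item of [p] is optimal. *)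
Lemma greedy_path_extend g g' p : 0 < g -> g' <= g -> greedy_path g' p ->
  (forall q x y, prefix (rcons q y) p -> greedy_path g (rcons q x) -> s x <= g') ->
  greedy_path g p.
Proof.
move=> g_gt0 le_g'; elim/last_ind: p => [|p y IH] py_path small.
  by split=> // -[].
have p_path : greedy_path g p.
  apply: IH => [|q x z q_pre]; first exact: greedy_path_prefix (prefix_rcons _ _) py_path.
  by apply: small; apply: prefix_trans q_pre (prefix_rcons _ _).
have [yp sy y_max] := greedy_path_last py_path.
have yo : y \in greedy_order s f g by rewrite mem_greedy_order (le_trans sy).
have /prefixP[[|x r] def_o] := prefix_greedy_order g_gt0 p_path.
  by rewrite def_o cats0 (negPf yp) in yo.
have px_path : greedy_path g (rcons p x).
  by apply: greedy_path_prefix (greedy_order_path g); rewrite def_o -cat_rcons prefix_prefix.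
have [xp _ x_max] := greedy_path_last px_path.
apply: greedy_path_rcons => //; first exact: le_trans le_g'.
move=> z sz zp; apply: le_trans (x_max z sz zp) _; apply: y_max => //.
by apply: small px_path; apply: prefix_refl.
Qed.

(** * The list built by the policy *)

Local Notation size_le := (fun x y => s x <= s y).

Lemma build_list_rcons t x : build_list s f (rcons t x) =
  if `[< indispensable s f x >] || (first_greedy s f x && (build_list s f t != [::]))
  then x :: build_list s f t else build_list s f t.
Proof. by rewrite /build_list foldl_rcons. Qed.

Lemma build_list_sub t : {subset build_list s f t <= t}.
Proof.
elim/last_ind: t => // t x IH y; rewrite build_list_rcons mem_rcons inE.
case: ifP => _; last by move/IH => ->; rewrite orbT.
by rewrite inE => /predU1P[->|/IH ->]; rewrite ?eqxx ?orbT.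
Qed.

Lemma build_list_sorted t : pairwise size_le t ->
  pairwise (fun x y => s y <= s x) (build_list s f t).
Proof.
elim/last_ind: t => // t x IH; rewrite pairwise_rcons => /andP[/allP le_x t_sorted].
rewrite build_list_rcons; case: ifP => _ /=; rewrite IH // andbT.
by apply/allP => y /build_list_sub; apply: le_x.
Qed.

Lemma mem_build_list t x : x \in build_list s f t ->
  indispensable s f x \/ first_greedy s f x.
Proof.
elim/last_ind: t => // t y IH; rewrite build_list_rcons; case: ifP => // def_y.
rewrite inE => /predU1P[->|/IH//].
by case/orP: def_y => [/asboolP|/andP[]]; [left | right].
Qed.

Lemma build_list_indispensable t x :
  x \in t -> indispensable s f x -> x \in build_list s f t.
Proof.
move=> + x_ind; elim/last_ind: t => // t y IH.
rewrite mem_rcons inE build_list_rcons => /predU1P[<-|/IH xt].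
  by rewrite (asboolT x_ind) mem_head.
by case: ifP; rewrite ?inE xt ?orbT.
Qed.

(** The smaller [y] is processed before [x], so the list is already non-empty when [x] is
    reached. *)
Lemma build_list_first t x y : pairwise size_le t -> x \in t ->
  first_greedy s f x -> y \in build_list s f t -> s y < s x ->
  x \in build_list s f t.
Proof.
move=> + + x_first + lt_yx; elim/last_ind: t => // t z IH.
rewrite pairwise_rcons => /andP[/allP le_z t_sorted].
rewrite mem_rcons inE build_list_rcons => /predU1P[<-|xt].
  case: ifP => [|/negbT]; first by rewrite mem_head.
  by rewrite x_first /= negb_or negbK => /andP[_ /eqP->].
have yz : y != z by apply: contraTneq (le_z x xt) => <-; rewrite -ltNge.
by case: ifP => _; rewrite ?inE ?(negPf yz) //= => /(IH t_sorted xt) ->;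
   rewrite ?orbT.
Qed.

(** * Steps 1 to 3 of the policy *)

(** An item that does not fit exceeds [C], so the candidates discarded with it exceed [C] as
    well. *)
Lemma step1P C F A : pairwise (fun x y => s y <= s x) F ->
  (forall y, s y <= C -> y \in A) ->
  match step1 s C F A with
  | (Some x, A') =>
      [/\ x \in F, s x <= C, forall y, y \in F -> s y <= C -> s y <= s x
        & forall y, s y <= C -> (y \in A') = (y != x)]
  | (None, A') =>
      (forall y, y \in F -> C < s y) /\ (forall y, s y <= C -> y \in A')
  end.
Proof.
elim: F A => [|x F IH] A //= /andP[/allP le_x F_sorted] A_small.
rewrite /fits size_of0 add0r; case: leP => [sx|lt_x].
  split=> //; first exact: mem_head.
    by move=> y /predU1P[->//|/le_x].
  by move=> y sy; rewrite !inE A_small // andbT.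
have /(IH _ F_sorted) : forall y, s y <= C -> y \in [set j in A | s j < s x].
  by move=> y sy; rewrite inE A_small //= (le_lt_trans sy).
case: step1 => [[y|] A'] [].
  move=> yF sy y_max A'_small; split=> //; first by rewrite inE yF orbT.
  by move=> z /predU1P[->|/y_max//]; rewrite leNgt lt_x.
move=> F_large A'_small; split=> // y /predU1P[->//|]; exact: F_large.
Qed.

Lemma foldl_step2 C S A p :
  size_of s (S :|: [set z in p]) <= C -> uniq p -> {in p, forall z, z \notin S} ->
  foldl (step2_item s C) (S, A) p = (S :|: [set z in p], A :\: [set z in p]).
Proof.
elim: p S A => [|x p IH] S A /= sp; first by rewrite set_nil setU0 setD0.
case/andP=> xp p_uniq pS.
have def_S : S :|: [set z in x :: p] = (x |: S) :|: [set z in p].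
  by apply/setP => z; rewrite !inE orbCA orbA.
have x_fits : fits s C S x.
  rewrite /fits addrC -size_ofU1; last exact/pS/mem_head.
  by apply: le_trans sp; rewrite def_S size_of_sub ?subsetUl.
rewrite {2}/step2_item /= x_fits IH -?def_S //.
  by congr (_, _); apply/setP => z; rewrite !inE negb_or andbCA andbA.
move=> z zp; rewrite !inE negb_or (pS z) ?inE ?zp ?orbT // andbT.
by apply: contraNneq xp => <-.
Qed.

Lemma foldl_step2_sub C (st : state N) p :
  st.1 \subset (foldl (step2_item s C) st p).1.
Proof.
elim: p st => //= x p IH st; apply: subset_trans (IH _).
by rewrite /step2_item /=; case: ifP => // _; apply: subsetUr.
Qed.

Lemma step3_item_sub C (st : state N) : st.1 \subset (step3_item s f C st).1.
Proof.
rewrite /step3_item; case: densest => // x; case: ifP => // _; exact: subsetUr.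
Qed.

Lemma step3_item_card C (st : state N) : (#|(step3_item s f C st).2| <= #|st.2|.-1)%N.
Proof.
rewrite /step3_item; have := densestP st.1 st.2.
case: densest => [x [xA _]|->]; last by rewrite cards0.
rewrite (cardsD1 x st.2) xA; case: ifP => //= _; apply: subset_leq_card.
apply/subsetP => y; rewrite !inE => /andP[-> lt_y]; rewrite andbT.
by apply: contraTneq lt_y => ->; rewrite ltxx.
Qed.

(** Invariant of Step 3 with target [q]. Candidates above [C] are left unspecified, as they never
    fit; once [q] is packed nothing more is required. *)
Definition tracks C q (st : state N) : Prop :=
  [set z in q] \subset st.1 \/
  exists p, [/\ prefix p q, st.1 = [set z in p]
    & forall y, s y <= C -> (y \in st.2) = (y \notin p)].

(** A choice above [C] discards only items above [C]. Any other choice extends [p] to a greedy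
    sequence for [C], which is comparable with [q]. *)
Lemma step3_item_tracks C q (st : state N) : 0 < C ->
  greedy_path C q -> size_seq q <= C ->
  tracks C q st -> tracks C q (step3_item s f C st).
Proof.
move=> C_gt0 q_path sq [q_sub|[p [p_pre def_S def_A]]].
  by left; apply: subset_trans q_sub (step3_item_sub _ _).
rewrite /step3_item; have := densestP st.1 st.2.
case: densest => [x [xA x_max]|_]; last by right; exists p.
have [sx|lt_x] := leP (s x) C; last first.
  rewrite /fits leNgt (lt_le_trans lt_x) ?lerDr ?size_of_ge0 //=.
  right; exists p; split=> // y sy.
  by rewrite inE def_A // (le_lt_trans sy) ?andbT.
have xp : x \notin p by rewrite -def_A.
have px_path : greedy_path C (rcons p x).
  apply: greedy_path_rcons => //; first exact: greedy_path_prefix q_path.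
  by move=> y sy yp; rewrite -def_S x_max // def_A.
have [px_pre|/prefix_of_rcons[q_pre|def_q]] := greedy_path_total C_gt0 px_path q_path.
- have le_px := le_trans (size_of_sub (set_prefix px_pre)) sq.
  rewrite /fits addrC -size_ofU1; last by rewrite def_S inE.
  rewrite def_S -set_rcons le_px; right; exists (rcons p x); split=> // y sy.
  by rewrite !inE mem_rcons inE negb_or def_A.
- left; apply: subset_trans (set_prefix q_pre) _.
  by rewrite -def_S; case: ifP => //= _; apply: subsetUr.
- have le_px := sq; rewrite def_q in le_px.
  rewrite /fits addrC -size_ofU1; last by rewrite def_S inE.
  by rewrite def_S -set_rcons le_px; left; rewrite def_q.
Qed.

Lemma policy_sub ord C : (after_step2 s f ord C).1 \subset policy s f ord C.
Proof.
rewrite /policy /step3_state; elim: #|N| => //= n IH.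
exact: subset_trans IH (step3_item_sub _ _).
Qed.

Lemma policy_tracks ord C q : 0 < C -> greedy_path C q -> size_seq q <= C ->
  tracks C q (after_step2 s f ord C) -> [set z in q] \subset policy s f ord C.
Proof.
move=> C_gt0 q_path sq q_tracks; rewrite /policy /step3_state.
have [st_tracks st_card] : tracks C q (step3_state s f ord C #|N|) /\
    (#|(step3_state s f ord C #|N|).2| <= #|N| - #|N|)%N.
  (* The occurrence kept fixed is the initial bound on the number of candidates; each round lowers
     it by one. *)
  rewrite /step3_state; elim: {1 2 4}#|N| => [|n [IHt IHc]] /=.
    by split=> //; rewrite subn0 max_card.
  split; first exact: step3_item_tracks.
  apply: leq_trans (step3_item_card _ _) _.
  by rewrite subnS; case: #|_| IHc => [|m] //= lt_m; rewrite -ltnS (ltn_predK lt_m).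
(* With no candidates left, every item of size at most [C] lies in [p]. *)
case: st_tracks => // -[p [_ -> def_A]].
have /cards0_eq A0 : #|(step3_state s f ord C #|N|).2| = 0%N.
  by apply/eqP; rewrite -leqn0 -[X in (_ <= X)%N](subnn #|N|).
apply/subsetP => y; rewrite !inE => yq; apply: negbNE.
by rewrite -def_A ?A0 ?inE // (greedy_path_mem q_path).
Qed.

(** * Comparison of the policy with AGreedy *)

(** Both sequences are greedy for [s y], hence comparable. If [x] is in [q], then [f [set x] <= f q
    < marg q y <= f [set y]]; [y] cannot be in [p], whose items are smaller than [x]. *)
Lemma indispensable_singleton_ge g p x y : greedy_path g (rcons p x) ->
  f [set z in p] < marg p x -> indispensable s f y ->
  s x <= s y -> s y <= g -> f [set x] <= f [set y].
Proof.
move=> px_path lt_x /indispensable_items_before[].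
set q := items_before s f y => qy_path lt_y le_xy sy.
have px_path' : greedy_path (s y) (rcons p x).
  apply: (greedy_path_restrict px_path) => // z.
  rewrite mem_rcons inE => /predU1P[->//|/(greedy_path_smaller px_path lt_x) lt_z].
  exact: ltW (lt_le_trans lt_z le_xy).
have [yq _ _] := greedy_path_last qy_path.
have [/prefix_of_rcons[xq_pre|/rcons_inj[_ ->]]|/prefix_of_rcons[yp_pre|/rcons_inj[_ ->]]]
  // := greedy_path_total (s_gt0 y) px_path' qy_path.
- apply: le_trans (ltW (lt_le_trans lt_y (marginal_le_singleton _))); last by rewrite inE.
  apply/f_mono; rewrite sub1set; apply: (subsetP (set_prefix xq_pre)).
  by rewrite inE mem_rcons mem_head.
- have yp : y \in p.
    have := subsetP (set_prefix yp_pre) y; rewrite !inE mem_rcons mem_head; exact.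
  by have := greedy_path_smaller px_path lt_x yp; rewrite ltNge le_xy.
Qed.

(* An item diverging from the greedy order [rcons p x] would itself be listed,
   in front of [x]. *)
Lemma indispensable_path C x : 0 < C -> s x <= C -> indispensable s f x ->
  (forall y, indispensable s f y -> s y <= C -> s y <= s x) ->
  (forall y, first_greedy s f y -> s y <= C -> s y <= s x) ->
  greedy_path C (rcons (items_before s f x) x).
Proof.
move=> C_gt0 sx /indispensable_items_before[].
set p := items_before s f x => px_path lt_x ind_max first_max.
have [xp _ _] := greedy_path_last px_path.
apply: (greedy_path_extend C_gt0 sx px_path) => q y z /prefix_of_rcons qz_pre qy_path.
have [yq sy y_max] := greedy_path_last qy_path.
have q_pre : prefix q p.
  case: qz_pre => [|/rcons_inj[-> _]]; last exact: prefix_refl.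
  exact: prefix_trans (prefix_rcons _ _).
have sub_qp := set_prefix q_pre.
have xq : x \notin q by have := subsetP sub_qp x; rewrite !inE => /contra; apply.
rewrite leNgt; apply/negP => lt_xy.
(* The excess passes from [x] to [y]: [f q <= f p < marg p x <= marg q y]. So [y] is a first item if
   [q] is empty, and indispensable otherwise. *)
have le_m : marg p x <= marg q y.
  apply: (le_trans (marginal_anti sub_qp _)); first by rewrite inE.
  by apply: marginal_le_of_density (y_max x sx xq); apply: ltW.
have lt_y : f [set w in q] < marg q y.
  by apply: le_lt_trans (lt_le_trans lt_x le_m); apply: f_mono.
case: (eqVneq q [::]) => [q0|q_nil].
  suff y_first : first_greedy s f y by have := first_max y y_first sy; rewrite leNgt lt_xy.
  by apply/first_greedyP; have := greedy_path_own_size qy_path lt_y; rewrite q0.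
have := ind_max y (indispensable_of_path qy_path q_nil lt_y) sy.
by rewrite leNgt lt_xy.
Qed.

(** A first item for [C] is also first for its own size, so it is no larger than [x]. *)
Lemma first_greedy_path C x : 0 < C -> s x <= C -> first_greedy s f x ->
  (forall y, first_greedy s f y -> s y <= C -> s y <= s x) ->
  greedy_path C [:: x].
Proof.
move=> C_gt0 sx /first_greedyP x_path first_max.
apply: (greedy_path_extend C_gt0 sx x_path) => q y z.
move=> /(@prefix_of_rcons _ [::])[|/rcons_inj[-> _] y_path].
  by rewrite prefixs0; case: q.
have [_ sy _] := greedy_path_last y_path.
apply: first_max => //; apply/first_greedyP.
by apply: (greedy_path_restrict y_path) => // w; rewrite inE => /eqP->.
Qed.

Lemma agreedy_le_policy ord C : perm_eq ord (enum N) ->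
  sorted size_le ord -> 0 < C -> f (agreedy s f C) <= f (policy s f ord C).
Proof.
move=> ord_perm ord_sorted C_gt0.
have mem_ord x : x \in ord by rewrite (perm_mem ord_perm) mem_enum.
have {}ord_sorted : pairwise size_le ord.
  by rewrite -sorted_pairwise // => x y z; apply: le_trans.
set q := take (greedy_len s f C) (greedy_order s f C).
have q_pre : prefix q (greedy_order s f C) by apply: prefix_take.
have q_path := greedy_path_prefix q_pre (greedy_order_path C).
have [sq _] : size_seq q <= C /\ _ := greedy_len_bounds C_gt0.
(* The listed [x] makes the list non-empty, so a larger first item would be listed too. *)
have first_max x : x \in build_list s f ord ->
    (forall y, y \in build_list s f ord -> s y <= C -> s y <= s x) ->
    forall y, first_greedy s f y -> s y <= C -> s y <= s x.
  move=> xF x_max y y_first sy; rewrite leNgt; apply/negP => lt_xy.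
  have := x_max y (build_list_first ord_sorted (mem_ord y) y_first xF lt_xy) sy.
  by rewrite leNgt lt_xy.
have ind_listed x : indispensable s f x -> x \in build_list s f ord.
  exact: build_list_indispensable.
have after1 := step1P (build_list_sorted ord_sorted) (fun y (_ : s y <= C) => in_setT y).
have sub2 := policy_sub ord C.
have [[y [-> def_y y_pre lt_y]]|[-> ag_q]] := agreedyP C_gt0.
  have y_ind : indispensable s f y.
    exists C; split=> //; rewrite /agreedy def_y /greedy_set leNgt.
    by rewrite -/q in lt_y *; rewrite lt_y.
  have y_path := greedy_path_prefix y_pre (greedy_order_path C).
  have [_ sy _] := greedy_path_last y_path.
  move: sub2; rewrite /after_step2 /after_step1.
  case: step1 after1 => [[x|] A]; last first.
    by case=> /(_ y (ind_listed y y_ind)); rewrite ltNge sy.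
  case=> xF sx x_max _ sub2.
  (* The item from Step 1 alone is enough; later steps only enlarge the packed set. *)
  apply: (@le_trans _ _ (f [set x])); last first.
    by apply/f_mono/(subset_trans _ sub2)/(@foldl_step2_sub C ([set x], A)).
  have le_yx := x_max y (ind_listed y y_ind) sy.
  case: (mem_build_list xF) => [x_ind|/first_greedyP/(@greedy_path_last _ [::])[_ _ d_max]].
    exact: indispensable_singleton_ge lt_y x_ind le_yx sx.
  (* Here [x] is first for capacity [s x], where [y] competes, so both its size and its density over
     [set0] are at least those of [y]. *)
  rewrite -!marginal0; apply: marginal_le_of_density => //.
  by have := d_max y le_yx; rewrite set_nil; apply.
apply/f_mono/policy_tracks => //.
rewrite -/q in ag_q *; rewrite /after_step2 /after_step1.
case: step1 after1 => [[x|] A]; last first.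
  by case=> _ A_small /=; right; exists [::]; split; rewrite ?prefix0s ?set_nil //.
case=> xF sx x_max A_small.
case: asboolP => [x_ind|x_nind] /=.
  have [_ lt_x] := indispensable_items_before x_ind.
  have [px_path sp] : greedy_path C (rcons (items_before s f x) x) /\
      size_seq (items_before s f x) <= C.
    split; last first.
      have [px_path _] := indispensable_items_before x_ind.
      exact: le_trans (greedy_path_size px_path lt_x) sx.
    apply: indispensable_path => // [y y_ind sy|]; last exact: first_max.
    by apply: x_max => //; apply: ind_listed.
  set p := items_before s f x in lt_x px_path sp *.
  have px_pre := prefix_greedy_order C_gt0 px_path.
  have p_pre : prefix p (greedy_order s f C) := prefix_trans (prefix_rcons _ _) px_pre.
  have [xp _ _] := greedy_path_last px_path.
  have px_q : prefix (rcons p x) q.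
    (* If AGreedy stopped right after [p], then [x] would be its next item and would be preferred to
       [p], contradicting [ag_q]. *)
    have := greedy_len_ge p_pre sp; rewrite leq_eqVlt => /predU1P[def_k|lt_k].
      have def_q : q = p by rewrite /q -def_k; apply/eqP; rewrite -prefixE.
      have def_x : next_item s f C = Some x.
        by rewrite /next_item -def_k (onth_prefix px_pre).
      by have := ag_q x def_x; rewrite def_q leNgt lt_x.
    move: px_pre; rewrite !prefixE size_rcons => /eqP def_px.
    by rewrite take_takel // def_px.
  have def_S : [set x] :|: [set z in p] = [set z in rcons p x] by rewrite set_rcons.
  rewrite foldl_step2.
  - right; exists (rcons p x); split=> //= y sy.
    by rewrite !inE A_small // mem_rcons inE negb_or andbC.
  - by rewrite def_S (le_trans _ sq) // size_of_sub // set_prefix.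
  - by have [] := px_path; rewrite rcons_uniq => /andP[].
  - by move=> z zp; rewrite inE; apply: contraNneq xp => <-.
(* Step 2 is empty here, and the tracked prefix is [[:: x]]. *)
have x_first : first_greedy s f x by case: (mem_build_list xF).
have x_path : greedy_path C [:: x].
  by apply: first_greedy_path => //; apply: first_max.
have x_pre := prefix_greedy_order C_gt0 x_path.
right; exists [:: x]; split=> /=.
- have := greedy_len_ge x_pre; rewrite -[[:: x]]/(rcons [::] x) set_rcons set_nil.
  rewrite size_ofU1 ?inE // size_of0 addr0 => /(_ sx) lt_k.
  by move: x_pre; rewrite !prefixE => /eqP def_x; rewrite take_takel // def_x.
- by apply/setP => z; rewrite !inE.
- by move=> y sy; rewrite A_small // inE.
Qed.

End Greedy.

Theorem theorem8 (R : realType) (N : finType) (s : N -> R) (f : {set N} -> R)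
    (s_gt0 : forall i : N, 0 < s i)
    (f_ge0 : forall A : {set N}, 0 <= f A)
    (f_norm : normalized f) (f_mono : monotone f) (f_submod : submodular f)
    (ord : seq N)
    (ord_perm : perm_eq ord (enum N))
    (ord_sorted : sorted (fun i j : N => s i <= s j) ord)
    (f_no_ties : no_ties s f ord)
    (C : R) (C_gt0 : 0 < C) :
  f (agreedy s f C) <= f (policy s f ord C).
Proof. by case: f_no_ties => order_no_ties _ _; apply: agreedy_le_policy. Qed.
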